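(* Let $G=(V,A)$ be a flow graph with start vertex $s$, let $F$ be a depth-first spanning tree of $G$ rooted at $s$ with vertices identified with their preorder numbers $1,\dots,n$, and let $f(v)$ be the parent of $v$ in $F$. For each $v\neq s$ let $\mathit{sd}(v)$, $\mathit{rd}(v)$ and $g(v)$ be as defined below. Process the vertices $v\neq s$ in increasing order: if $\mathit{sd}(v)=\mathit{sd}(\mathit{rd}(v))$ or $b(\mathit{rd}(v))=f(\mathit{rd}(v))$, set $b(v)=g(v)$ and $r(v)=f(v)$; otherwise set $b(v)=f(v)$ and $r(v)=g(v)$. Let $B$ (resp. $R$) be the graph with vertex set $V$ and arcs $(b(v),v)$ (resp. $(r(v),v)$) for $v\neq s$ (these are spanning trees rooted at $s$). Then $B$ and $R$ are independent: for every vertex $v$, the path in $B$ from $s$ to $v$ and the path in $R$ from $s$ to $v$ have in common only vertices that dominate $v$.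
   Context: A flow graph is a finite directed graph $G=(V,A)$ with start vertex $s$ such that every vertex is reachable from $s$; there are no arcs entering $s$ and $n=|V|>1$. A vertex $u$ dominates $v$ if every path from $s$ to $v$ contains $u$. A path from $u$ to $v$ is high if all its vertices other than $u$ and $v$ are greater (in the preorder numbering of $F$) than both $u$ and $v$. For $v\neq s$, the semi-dominator $\mathit{sd}(v)$ is the minimum vertex $u$ such that there is a high path from $u$ to $v$. For $v\neq s$, $F(\mathit{sd}(v),v]$ denotes the path in $F$ from the child of $\mathit{sd}(v)$ that is an ancestor of $v$ down to $v$; the relative dominator $\mathit{rd}(v)$ is the vertex $x$ on $F(\mathit{sd}(v),v]$ with $\mathit{sd}(x)$ minimum, ties broken in favor of the smallest $x$. For each $v\neq s$, $(g(v),v)\in A$ is an arc that is the last arc on some high path from $\mathit{sd}(v)$ to $v$. *)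

(* Defs.v *)
From mathcomp Require Import all_boot.

Set Implicit Arguments.
Unset Strict Implicit.
Unset Printing Implicit Defensive.

Section Graphs.

Variable V : finType.
Implicit Types (e T : rel V) (s u v w x y : V) (p q o : seq V).

(* Paths are simple; u :: p is the vertex sequence.  Simplicity matters for
   [last_arc_of_high_path]: otherwise a cycle through v could be appended to a
   high path to v without affecting highness. *)
Definition path_from_to e u v p :=
  [/\ path e u p, last u p = v & uniq (u :: p)].

Definition flow_graph e s :=
  [/\ 1 < #|V|, (forall u, ~~ e u s) &
      forall v, exists p, path_from_to e s v p].

Definition dominates e s u v :=
  forall p, path_from_to e s v p -> u \in s :: p.

Definition spanning_tree e s T :=
  [/\ subrel T e,
      (forall u, ~~ T u s),
      (forall v, v != s -> exists! u, T u v) &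
      (forall v, exists p, path_from_to T s v p)].

Definition independent e s T1 T2 :=
  forall v p q, path_from_to T1 s v p -> path_from_to T2 s v q ->
  forall x, x \in s :: p -> x \in s :: q -> dominates e s x v.

Definition parent_graph s (h : V -> V) : rel V :=
  [rel u v | (v != s) && (u == h v)].

(* The states of a depth-first search: o lists the vertices reached so far, in
   the order in which they were reached (i.e. in preorder), and f v is the
   vertex from which v was reached.  The search always advances from the most
   recently reached vertex that still has an arc to an unreached vertex. *)
Inductive dfs e s (f : V -> V) : seq V -> Prop :=
| dfs_start : dfs e s f [:: s]
| dfs_advance o v of
    dfs e s f o & v \notin o & f v \in o & e (f v) v &
    (forall u w, u \in o -> index (f v) o < index u o -> e u w -> w \in o) :
    dfs e s f (rcons o v).

Definition dfs_spanning_tree e s f o := dfs e s f o /\ forall v, v \in o.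

Definition preorder o v := (index v o).+1.

(* In what follows, num is a vertex numbering (the preorder of the tree). *)

Definition high_path e (num : V -> nat) u v p :=
  path_from_to e u v p /\
  forall x, x \in u :: p -> x != u -> x != v ->
    (num u < num x) && (num v < num x).

Definition is_semidominator e (num : V -> nat) v u :=
  (exists p, high_path e num u v p) /\
  forall w, (exists p, high_path e num w v p) -> num u <= num w.

Definition ancestor s (f : V -> V) u v := connect (parent_graph s f) u v.

(* x lies on F(u, v], where F is the tree with parent function f; c is the
   child of u at which that path starts. *)
Definition on_tree_path s (f : V -> V) u v x :=
  exists c, [/\ parent_graph s f u c, ancestor s f c x & ancestor s f x v].

Definition is_relative_dominator s f (num : V -> nat) (sd : V -> V) v x :=
  on_tree_path s f (sd v) v x /\
  forall y, on_tree_path s f (sd v) v y ->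
    (num (sd x) < num (sd y)) || (sd x == sd y) && (num x <= num y).

Definition last_arc_of_high_path e (num : V -> nat) u v w :=
  e w v /\ exists p, high_path e num u v (rcons p v) /\ last u p = w.

Definition update (h : V -> V) v y : V -> V :=
  fun x => if x == v then y else h x.

Definition br_step (f sd rd g : V -> V) (br : (V -> V) * (V -> V)) v :=
  let: (b, r) := br in
  if (sd v == sd (rd v)) || (b (rd v) == f (rd v))
  then (update b v (g v), update r v (f v))
  else (update b v (f v), update r v (g v)).

(* The initial values (here the identity) are irrelevant: every v != s gets
   assigned, and b (rd v) is consulted before rd v has been assigned only when
   rd v = v, in which case the first disjunct of the test is true. *)
Definition br_trees s o f sd rd g : (V -> V) * (V -> V) :=
  foldl (br_step f sd rd g) (id, id) [seq v <- o | v != s].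

End Graphs.

(* Main.v *)
From mathcomp Require Import all_boot all_order zify.
Require Import Defs.

(* Write num for preorder numbers, and let minlow v a be the least num (sd u)
   over the ancestors u of v with num u > a, capped at a.  Iterating minlow v
   from a = num (sd v) climbs along v, rd v, rd (rd v), ..., and b v = g v
   exactly when the number of steps is even.  Counting the steps so that the
   count is monotone in a gives height v a.

   Each descendant v of a vertex c gets the label
   label c v = height v (minlow v (num c)), and labels restrict along the tree
   by label c v = min (label c c') (label c' v) when c' lies between c and v.
   For each parity k, comparing the labels of two vertices at their nearest
   common ancestor defines a strict order precedes k: labels of parity k come
   first, in increasing order, then those of the other parity, in decreasing
   order.  Every arc of B (k even) and of R (k odd) is increasing for its order,
   so B and R are trees.  A vertex t precedes v in both orders only when t is an
   ancestor of v with minlow v (num t) = num t; then no semidominator on the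
   tree path from t to v lies above t, so t dominates v. *)

Set Implicit Arguments.
Unset Strict Implicit.
Unset Printing Implicit Defensive.

Import Order.TTheory.

Section Descent.

Variable m : nat -> nat.
Implicit Types a b k : nat.

(* The number of steps in which m descends from a to a fixed point c, plus 2c;
   the term 2c is even and makes the count monotone in a.  The fuel k suffices
   when it exceeds a. *)
Fixpoint fueled_descent k a :=
  if k is k'.+1 then
    if m a < a then (fueled_descent k' (m a)).+1 else a.*2
  else 0.

Definition descent a := fueled_descent a.+1 a.

Lemma fueled_descentE k a : a < k -> fueled_descent k a = descent a.
Proof.
rewrite /descent; elim/ltn_ind: a k => a IH [|k] //= ak.
by case: ifP => // ma; rewrite !(IH (m a)) //; lia.
Qed.

Lemma descentE a : descent a = if m a < a then (descent (m a)).+1 else a.*2.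
Proof. by rewrite {1}/descent /=; case: ifP => // ma; rewrite fueled_descentE. Qed.

Lemma descent_step a : m a < a -> descent a = (descent (m a)).+1.
Proof. by rewrite descentE => ->. Qed.

Lemma descent_fix a : m a = a -> descent a = a.*2.
Proof. by rewrite descentE => ->; rewrite ltnn. Qed.

Lemma descent_le_double a : descent a <= a.*2.
Proof.
elim/ltn_ind: a => a IH; rewrite descentE; case: ifP => // ma.
by have := IH _ ma; lia.
Qed.

Lemma descent_mono : {homo m : a b / a <= b} -> {homo descent : a b / a <= b}.
Proof.
move=> m_mono a b; elim/ltn_ind: b a => b IH a ab.
rewrite [descent b]descentE; case: ifP => mb; last first.
  by have := descent_le_double a; lia.
have [ma|am] := ltnP (m a) a; first by rewrite descent_step // ltnS IH // m_mono.
by rewrite ltnW // ltnS IH //; have := m_mono _ _ ab; lia.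
Qed.

End Descent.

Lemma eq_descent m1 m2 a :
  (forall x, m1 x <= x) -> (forall x, x <= a -> m1 x = m2 x) ->
  descent m1 a = descent m2 a.
Proof.
move=> m1_le; elim/ltn_ind: a => a IH m12; rewrite descentE [RHS]descentE -m12 //.
case: ifP => // ma; congr _.+1; apply: IH => // x xma.
by apply: m12; lia.
Qed.

Section ParityOrder.

Variable k : bool.
Implicit Types i m n : nat.

(* Numbers of parity k in increasing order, then the others in decreasing order. *)
Definition parity_lt m n := (m < n) && (odd m == k) || (n < m) && (odd n != k).

Lemma parity_lt_irr : irreflexive parity_lt.
Proof. by move=> n; rewrite /parity_lt ltnn. Qed.

Lemma parity_lt_trans : transitive parity_lt.
Proof. by rewrite /parity_lt => l m n; case: k; lia. Qed.

Lemma parity_lt_min i m n : parity_lt m n ->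
  parity_lt (minn i m) (minn i n) \/ minn i m = minn i n.
Proof. by rewrite /parity_lt; case: k; lia. Qed.

Lemma parity_lt_min_inv i m n : parity_lt (minn i m) (minn i n) -> parity_lt m n.
Proof. by rewrite /parity_lt; case: k; lia. Qed.

End ParityOrder.

Record preorder_tree (V : finType) (anc : rel V) (num : V -> nat) (s : V) : Prop :=
  PreorderTree {
    anc_refl : reflexive anc;
    anc_trans : transitive anc;
    anc_root : forall v, anc s v;
    anc_num : forall u v, anc u v -> num u <= num v;
    num_inj : injective num;
    anc_interval : forall u w x, anc u w -> num u <= num x <= num w -> anc u x
  }.

Lemma ltn_image_neq (T : eqType) (h : T -> nat) x y : h x < h y -> x != y.
Proof. by apply: contraTneq => ->; rewrite ltnn. Qed.

Section NearestCommonAncestor.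

Variables (V : finType) (anc : rel V) (num : V -> nat) (s : V).
Hypothesis treeP : preorder_tree anc num s.

Implicit Types c t u v w y : V.

Lemma neq_num_lt u v : u != v -> num u <= num v -> num u < num v.
Proof.
by move=> uv; rewrite ltn_neqAle => ->; rewrite andbT (inj_eq (num_inj treeP)).
Qed.

Lemma anc_antisym : antisymmetric anc.
Proof.
move=> u v /andP[uv vu]; apply: (num_inj treeP).
by apply/eqP; rewrite eqn_leq !(anc_num treeP).
Qed.

Lemma anc_linear u v w : anc u w -> anc v w -> num u <= num v -> anc u v.
Proof.
by move=> uw vw uv; apply: (anc_interval treeP uw); rewrite uv (anc_num treeP).
Qed.

Lemma num_subtree c v w u : anc c v -> anc c w -> ~~ anc c u ->
  (num u < num v) = (num u < num w) /\ (num v < num u) = (num w < num u).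
Proof.
move=> cv cw cu; have [cu_le|uc_lt] := leqP (num c) (num u).
  have below z : anc c z -> num z < num u.
    move=> cz; rewrite ltnNge; apply: contra cu => uz.
    by apply: (anc_interval treeP cz); rewrite cu_le.
  by have := below v cv; have := below w cw; lia.
by have := anc_num treeP cv; have := anc_num treeP cw; lia.
Qed.

Definition nca t v := [arg max_(c > s | anc c t && anc c v) num c].

Lemma ncaP t v : [/\ anc (nca t v) t, anc (nca t v) v &
  forall u, anc u t -> anc u v -> anc u (nca t v)].
Proof.
rewrite /nca; case: arg_maxnP => [|c /andP[ct cv] cmax].
  by rewrite !(anc_root treeP).
by split=> // u ut uv; apply: (anc_linear ut ct); apply: cmax; rewrite ut.
Qed.

Lemma nca_eq t v c : anc c t -> anc c v ->
  (forall u, anc u t -> anc u v -> anc u c) -> nca t v = c.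
Proof.
move=> ct cv cmax; have [nt nv nmax] := ncaP t v.
by apply: anc_antisym; rewrite cmax // nmax.
Qed.

Lemma ncaC t v : nca t v = nca v t.
Proof.
have [cv ct cmax] := ncaP v t.
by apply: nca_eq => // u ut uv; apply: cmax.
Qed.

Lemma nca_idl c v : anc c v -> nca c v = c.
Proof. by move=> cv; apply: nca_eq => //; exact: anc_refl treeP _. Qed.

Lemma nca_shallowl t y v : num (nca t y) < num (nca y v) ->
  nca t v = nca t y /\ ~~ anc (nca y v) t.
Proof.
have [ct cy cmax] := ncaP t y; have [dy dv _] := ncaP y v.
set c := nca t y in ct cy cmax *; set d := nca y v in dy dv * => lt.
have ndt : ~~ anc d t.
  by apply: contraL lt => dt; rewrite -leqNgt; apply/(anc_num treeP)/cmax.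
have cd := anc_linear cy dy (ltnW lt).
split=> //; apply: nca_eq => // [|u ut uv]; first exact: (anc_trans treeP) cd dv.
have [ud|/ltnW du] := leqP (num u) (num d).
  by apply: cmax => //; apply: (anc_trans treeP) dy; apply: anc_linear uv dv ud.
by case/negP: ndt; apply: (anc_trans treeP) ut; apply: anc_linear dv uv du.
Qed.

Lemma nca_shallowr t y v : num (nca y v) < num (nca t y) ->
  nca t v = nca y v /\ ~~ anc (nca t y) v.
Proof. by rewrite (ncaC t) (ncaC y) (ncaC t v); apply: nca_shallowl. Qed.

End NearestCommonAncestor.

Section DescentOrders.

Variables (V : finType) (anc : rel V) (num low : V -> nat) (s : V).
Hypothesis treeP : preorder_tree anc num s.

Implicit Types (a b : nat) (k : bool) (c t u v w y : V).

Local Notation nca := (nca anc num s).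

Definition minlow v a := \big[Order.min/a]_(u | anc u v && (a < num u)) low u.

Lemma minlow_le v a : minlow v a <= a.
Proof. exact: (@bigmin_le_id _ nat). Qed.

Lemma minlow_le_low v a u : anc u v -> a < num u -> minlow v a <= low u.
Proof. by move=> uv au; apply: (@bigmin_le_cond _ nat); rewrite uv. Qed.

Lemma leq_minlow v a b : b <= a ->
  (forall u, anc u v -> a < num u -> b <= low u) -> b <= minlow v a.
Proof.
by move=> ba b_low; apply: (@le_bigmin _ nat) => // u /andP[uv au]; apply: b_low.
Qed.

Lemma minlow_mono v : {homo minlow v : a b / a <= b}.
Proof.
move=> a b ab; apply: leq_minlow => [|u uv bu].
  exact: leq_trans (minlow_le _ _) ab.
by apply: minlow_le_low => //; apply: leq_ltn_trans bu.
Qed.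

Lemma minlow_self v : minlow v (num v) = num v.
Proof.
apply/eqP; rewrite eqn_leq minlow_le leq_minlow // => u /(anc_num treeP).
by rewrite leqNgt => /negP.
Qed.

Lemma minlow_split c v a : anc c v -> a <= num c ->
  minlow v a = minn (minlow c a) (minlow v (num c)).
Proof.
move=> cv ac; apply/eqP; rewrite eqn_leq leq_min minlow_mono // andbT.
apply/andP; split; apply: leq_minlow => [|u u_anc au].
- exact: minlow_le.
- by apply: minlow_le_low => //; apply: (anc_trans treeP) cv.
- by rewrite geq_min minlow_le.
rewrite geq_min; have [uc|cu] := leqP (num u) (num c).
  by rewrite minlow_le_low //; apply: (anc_linear treeP) u_anc cv uc.
by rewrite (minlow_le_low u_anc cu) orbT.
Qed.

Lemma minlow_cap v a b : b <= a ->
  (forall u, anc u v -> b < num u -> a < num u) ->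
  minlow v b = minn b (minlow v a).
Proof.
move=> ba gap; apply/eqP; rewrite eqn_leq leq_min minlow_le minlow_mono //=.
apply: leq_minlow => [|u uv bu]; first exact: geq_minl.
by rewrite geq_min minlow_le_low ?orbT ?gap.
Qed.

Definition height v := descent (minlow v).

Lemma height_mono v : {homo height v : a b / a <= b}.
Proof. exact/descent_mono/minlow_mono. Qed.

Lemma height_anc c v a : anc c v -> a <= minlow v (num c) -> height v a = height c a.
Proof.
move=> cv a_le; apply: eq_descent => [|x xa]; first exact: minlow_le.
have v_le := minlow_le v (num c); have c_le := minlow_le c x.
by rewrite (minlow_split cv); lia.
Qed.

Definition label c v := height v (minlow v (num c)).

Lemma label_self c : label c c = (num c).*2.
Proof. by rewrite /label /height minlow_self descent_fix // minlow_self. Qed.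

Lemma height_minlow c v a : anc c v -> a <= num c ->
  height v (minlow v a) = minn (height c (minlow c a)) (label c v).
Proof.
move=> cv ac; rewrite (minlow_split cv ac) /label.
set x := minlow c a; set y := minlow v (num c).
have [xy|/ltnW yx] := leqP x y.
  by rewrite -(height_anc cv xy); apply/esym/minn_idPl/height_mono.
by apply/esym/minn_idPr; rewrite (height_anc cv) // height_mono.
Qed.

Lemma label_split c c' v : anc c c' -> anc c' v ->
  label c v = minn (label c c') (label c' v).
Proof. by move=> cc' c'v; apply: height_minlow c'v (anc_num treeP cc'). Qed.

(* When the labels tie, c itself comes first; two branches at c are then
   compared only when their label has parity k, so that the two orders share no
   such pair, and in decreasing order, because that is the direction of the
   cross arcs (g v, v). *)
Definition precedes_at k c t v :=
  parity_lt k (label c t) (label c v) ||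
  [&& label c t == label c v, v != c &
      (t == c) || (odd (label c v) == k) && (num v < num t)].

Definition precedes k t v := precedes_at k (nca t v) t v.

Lemma precedes_irr k : irreflexive (precedes k).
Proof.
move=> v; rewrite /precedes nca_idl ?(anc_refl treeP) //.
by rewrite /precedes_at parity_lt_irr !eqxx.
Qed.

Lemma precedes_at_trans k c : transitive (precedes_at k c).
Proof.
move=> y t v; rewrite /precedes_at.
case/orP=> [ty|/and3P[/eqP ty yc]].
  by case/orP=> [/(parity_lt_trans ty)->//|/and3P[/eqP<- _ _]]; rewrite ty.
rewrite (negPf yc) ty /= => tie.
case/orP=> [->//|/and4P[/eqP yv -> /eqP k_v vy]]; apply/orP; right.
rewrite yv eqxx /=; case/orP: tie => [->//|/andP[_ yt]].
by rewrite k_v eqxx (ltn_trans vy yt) orbT.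
Qed.

Section Branching.

Variables c c' : V.
Hypotheses (cc' : anc c c') (c_lt : num c < num c').

Lemma subtree_neq v : anc c' v -> v != c.
Proof.
by move=> c'v; rewrite eq_sym (ltn_image_neq (leq_trans c_lt (anc_num treeP c'v))).
Qed.

Lemma precedes_at_coarsen k t v : anc c' t -> anc c' v ->
  precedes_at k c' t v -> precedes_at k c t v \/ label c t = label c v.
Proof.
move=> c't c'v; rewrite /precedes_at (label_split cc' c't) (label_split cc' c'v).
by case/orP=> [/(parity_lt_min (label c c'))[->|]|/andP[/eqP-> _]]; [left|right|right].
Qed.

Lemma precedes_at_branch k t v w : anc c' v -> anc c' w -> ~~ anc c' t ->
  label c v = label c w ->
  precedes_at k c v t = precedes_at k c w t /\
  precedes_at k c t v = precedes_at k c t w.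
Proof.
move=> c'v c'w c't E; rewrite /precedes_at E.
rewrite !(negPf (subtree_neq c'v)) !(negPf (subtree_neq c'w)).
by have [-> ->] := num_subtree treeP c'v c'w c't.
Qed.

Lemma precedes_at_refine k t y v : anc c' t -> anc c' v -> ~~ anc c' y ->
  precedes_at k c t y -> precedes_at k c y v -> precedes_at k c' t v.
Proof.
move=> c't c'v c'y ty yv.
suff lt : parity_lt k (label c t) (label c v).
  move: lt; rewrite (label_split cc' c't) (label_split cc' c'v) /precedes_at.
  by move/parity_lt_min_inv->.
case/orP: ty => [ty|/and3P[/eqP ty yc]].
  by case/orP: yv => [/(parity_lt_trans ty)//|/and3P[/eqP<-]].
rewrite (negPf (subtree_neq c't)) /= => /andP[_ yt].
case/orP: yv => [|/and3P[_ _]]; first by rewrite ty.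
rewrite (negPf yc) /= => /andP[_]; rewrite ltnNge.
by rewrite (ltnW _) // (num_subtree treeP c'v c't c'y).1.
Qed.

End Branching.

Lemma precedes_trans k : transitive (precedes k).
Proof.
move=> y t v; rewrite /precedes.
have [ct cy cmax] := ncaP treeP t y; have [dy dv dmax] := ncaP treeP y v.
case: (ltngtP (num (nca t y)) (num (nca y v))) => [lt|lt|/(num_inj treeP) E] ty yv.
- have [-> ndt] := nca_shallowl treeP lt.
  have cd := anc_linear treeP cy dy (ltnW lt).
  have [/(precedes_at_trans ty)//|E] := precedes_at_coarsen cd dy dv yv.
  by rewrite -(precedes_at_branch lt k dy dv ndt E).2.
- have [-> ncv] := nca_shallowr treeP lt.
  have dc := anc_linear treeP dy cy (ltnW lt).
  have [ty'|E] := precedes_at_coarsen dc ct cy ty.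
    exact: precedes_at_trans ty' yv.
  by rewrite (precedes_at_branch lt k ct cy ncv E).1.
have [nt nv nmax] := ncaP treeP t v; rewrite -E in dv dmax yv.
have cn := nmax _ ct dv.
have [<-|ne] := eqVneq (nca t y) (nca t v); first exact: precedes_at_trans ty yv.
have lt := neq_num_lt treeP ne (anc_num treeP cn).
apply: (precedes_at_refine cn lt nt nv _ ty yv).
by apply: contraL lt => ny; rewrite -leqNgt; apply/(anc_num treeP)/cmax.
Qed.

Lemma precedes_anc k c v : anc c v -> c != v ->
  precedes k c v = (minlow v (num c) == num c) || (odd (height v (num c)) == k).
Proof.
move=> cv neq; rewrite /precedes nca_idl // /precedes_at label_self eqxx (eq_sym v) neq.
rewrite /label; have := minlow_le v (num c); rewrite leq_eqVlt => /orP[/eqP E|lt].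
  by rewrite E /height descent_fix // !eqxx orbT.
have := descent_le_double (minlow v) (minlow v (num c)).
by rewrite /height (descent_step lt) /parity_lt /=; case: k; lia.
Qed.

Lemma precedes_both t v : precedes false t v -> precedes true t v ->
  anc t v /\ minlow v (num t) = num t.
Proof.
move=> tvF tvT; have tc : t = nca t v.
  move: tvF tvT; rewrite /precedes /precedes_at; set c := nca t v.
  have [->|_] := eqVneq t c; first by [].
  by rewrite /parity_lt; case: eqVneq => [->|_]; lia.
have [_ + _] := ncaP treeP t v; rewrite -tc => tv; split=> //.
have neq : t != v by apply: contraTneq tvF => ->; rewrite precedes_irr.
move: tvF tvT; rewrite !precedes_anc //; case: eqVneq => //= _.
by case: odd.
Qed.

Lemma minlow_nca v w : num v < num w ->
  minlow w (num (nca w v)) = minn (num (nca w v)) (minlow w (num v)).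
Proof.
have [_ cv cmax] := ncaP treeP w v => vw; apply: minlow_cap => [|u uw].
  exact: (anc_num treeP).
apply: contraTltn => uv; rewrite -leqNgt; apply/(anc_num treeP)/cmax => //.
by apply: (anc_interval treeP uw); rewrite uv ltnW.
Qed.

Lemma precedes_cross k w v : num v < num w -> low v < num v ->
  low v <= num (nca w v) -> minlow w (num v) = low v ->
  odd (height v (low v)) = k -> precedes k w v.
Proof.
move=> vw low_lt low_c mw odd_h; have [cw cv _] := ncaP treeP w v.
have m_c := minlow_nca vw; rewrite mw (minn_idPr low_c) in m_c.
rewrite /precedes; set c := nca w v in cw cv low_c m_c *.
have label_w : label c w = height c (low v) by rewrite -(height_anc cw) -m_c.
rewrite /precedes_at label_w vw andbT.
have [vc|vc] := eqVneq v c.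
  have h_lt : height v (low v) < (num v).*2.
    by apply: leq_ltn_trans (descent_le_double _ _) _; rewrite ltn_double.
  by rewrite -vc label_self /parity_lt h_lt odd_h eqxx.
have [low_le|lt_low] := leqP (low v) (minlow v (num c)).
  have low_E : minlow v (num c) = low v.
    apply/eqP; rewrite eqn_leq low_le minlow_le_low ?(anc_refl treeP) //.
    by rewrite (neq_num_lt treeP) // ?(anc_num treeP) // eq_sym.
  by rewrite /label low_E odd_h (height_anc cv low_le) !eqxx !orbT.
set L := label c v; pose H := height c (minlow c (low v)).
have L_lt : L < (low v).*2.
  by apply: leq_ltn_trans (descent_le_double _ _) _; rewrite ltn_double.
have odd_min : odd (minn H L) != k.
  have m_lt : minlow v (low v) < low v.
    by apply: leq_ltn_trans lt_low; apply: minlow_mono.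
  move: odd_h; rewrite /height (descent_step m_lt) -/(height v _).
  by rewrite (height_minlow cv low_c) /= => <-; case: odd.
have h_c : height c (low v) = H.+1 \/ L < H /\ height c (low v) = H.
  have := minlow_le c (low v); rewrite leq_eqVlt => /orP[/eqP E|lt].
    by right; rewrite /H E {1}/height descent_fix.
  by left; apply: descent_step.
by move: odd_min h_c; rewrite /parity_lt; case: (k); lia.
Qed.

End DescentOrders.

Section ParentGraph.

Variables (V : finType) (e : rel V) (s : V) (h : V -> V).
Implicit Types u v : V.

Lemma ancestor_refl : reflexive (ancestor s h).
Proof. by move=> v; apply: connect0. Qed.

Lemma ancestor_trans : transitive (ancestor s h).
Proof. by move=> v u w; apply: connect_trans. Qed.

Lemma ancestor_parent v : v != s -> ancestor s h (h v) v.
Proof. by move=> vs; apply: connect1; rewrite /parent_graph /= vs eqxx. Qed.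

Lemma ancestor_via_parent u v : ancestor s h u v -> u != v ->
  v != s /\ ancestor s h u (h v).
Proof.
case/connectP=> p; case/lastP: p => [_ ->|p x]; first by rewrite eqxx.
rewrite rcons_path last_rcons => /andP[pp /andP[xs /eqP lp]] -> _.
by split=> //; apply/connectP; exists p.
Qed.

Lemma ancestor_via_child u v : ancestor s h u v -> u != v ->
  exists2 c, parent_graph s h u c & ancestor s h c v.
Proof.
case/connectP=> -[|c p] /=; first by move=> _ ->; rewrite eqxx.
by case/andP=> uc cp -> _; exists c => //; apply/connectP; exists p.
Qed.

Section Monotone.

Variable R : rel V.
Hypothesis R_trans : transitive R.
Hypothesis R_parent : forall v, v != s -> R (h v) v.

Lemma ancestor_rel u v : ancestor s h u v -> u != v -> R u v.
Proof.
case/connectP=> p; elim: p u => [|w p IH] u /=; first by move=> _ ->; rewrite eqxx.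
case/andP=> /andP[ws /eqP->] wp lv _; have [<-|wv] := eqVneq w v; first exact: R_parent.
exact: R_trans (R_parent ws) (IH w wp lv wv).
Qed.

Lemma ancestor_root v : irreflexive R -> ancestor s h s v.
Proof.
move=> R_irr; have [m] := ubnP #|[set u | R u v]|; elim: m v => // m IH v.
rewrite ltnS => v_m; have [->|vs] := eqVneq v s; first exact: ancestor_refl.
apply: ancestor_trans (ancestor_parent vs); apply/IH/(leq_trans _ v_m).
apply/proper_card/properP; split.
  by apply/subsetP=> u; rewrite !inE => uh; apply: R_trans uh (R_parent vs).
by exists (h v); rewrite !inE ?R_irr ?R_parent.
Qed.

End Monotone.

Lemma parent_graph_spanning_tree :
  (forall v, v != s -> e (h v) v) -> (forall v, ancestor s h s v) ->
  spanning_tree e s (parent_graph s h).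
Proof.
move=> arc root; split=> [u v /andP[vs /eqP->]|u|v vs|v].
- exact: arc.
- by rewrite /parent_graph /= eqxx.
- by exists (h v); split=> [|u /andP[_ /eqP]//]; rewrite /parent_graph /= vs eqxx.
case/connectP: (root v) => p sp ->.
by case/shortenP: sp => q sq uq _; exists q.
Qed.

Lemma mem_path_ancestor v p x :
  path_from_to (parent_graph s h) s v p -> x \in s :: p -> ancestor s h x v.
Proof.
case=> sp <- _ xp; case/splitPl: xp sp => p1 p2 <-.
by rewrite cat_path last_cat => /andP[_ xp2]; apply/connectP; exists p2.
Qed.

End ParentGraph.

Lemma index_lt_split (T : eqType) (l l' : seq T) v x : v \notin l ->
  (index x (l ++ v :: l') < index v (l ++ v :: l')) = (x \in l).
Proof.
move=> vl; have -> : index v (l ++ v :: l') = size l.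
  by rewrite index_cat (negPf vl) /= eqxx addn0.
by rewrite index_cat; case: ifP => [|_]; rewrite ?index_mem // ltnNge leq_addr.
Qed.

Section DepthFirstSearch.

Variables (V : finType) (e : rel V) (s : V) (f : V -> V).
Implicit Types (u v w x : V) (l o p : seq V).

Lemma dfs_uniq o : dfs e s f o -> uniq o.
Proof. by elim=> // l v _ ul vl _ _ _; rewrite rcons_uniq vl. Qed.

Lemma dfs_head o : dfs e s f o -> exists l, o = s :: l.
Proof. by elim=> [|_ v _ [l ->] _ _ _ _]; [exists [::] | exists (rcons l v)]. Qed.

Lemma dfs_split l v l' : dfs e s f (l ++ v :: l') -> l != [::] ->
  [/\ v \notin l, f v \in l, e (f v) v &
      forall u w, u \in l -> index (f v) l < index u l -> e u w -> w \in l].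
Proof.
move oE: (l ++ _) => o o_dfs; elim: o_dfs l' oE => [|o' x _ IH xo fxo ex scan] l'.
  by case: l => [|y [|z l]].
case/lastP: l' => [|l' y].
  by rewrite cats1 => /rcons_inj[-> ->].
by rewrite -rcons_cons -rcons_cat => /rcons_inj[/IH].
Qed.

Variable o : seq V.
Hypothesis F_dfs : dfs_spanning_tree e s f o.

Local Notation anc := (ancestor s f).
Local Notation num := (preorder o).

Lemma preorder_inj : injective num.
Proof.
move=> u v [E]; have oV := F_dfs.2.
by rewrite -(nth_index s (oV u)) E nth_index.
Qed.

Lemma preorder_root v : num s <= num v.
Proof. by have [l ->] := dfs_head F_dfs.1; rewrite /preorder /= eqxx. Qed.

Lemma preorder_neq_root u v : num u < num v -> v != s.
Proof. by apply: contraTneq => ->; rewrite -leqNgt preorder_root. Qed.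

Lemma preorder_parent v : v != s ->
  [/\ num (f v) < num v, e (f v) v &
      forall u w, num (f v) < num u < num v -> e u w -> num w < num v].
Proof.
move=> vs; have := F_dfs.1; have [l0 oE] := dfs_head F_dfs.1.
rewrite /preorder; case/splitPr: (F_dfs.2 v) oE => l l' oE.
have l_neq0 : l != [::] by apply: contraNneq vs => l0E; move: oE; rewrite l0E => -[->].
case/dfs_split=> // vl fvl ev scan.
have before x := index_lt_split l' x vl.
rewrite !ltnS before; split=> // u w; rewrite !ltnS !before => /andP[fu ul] uw.
by apply: scan uw => //; move: fu; rewrite !index_cat fvl ul.
Qed.

(* u is still being scanned when v is reached, so it lies on the search stack. *)
Lemma crossing_arc_ancestor u w v : e u w -> num u < num v <= num w -> anc u v.
Proof.
move=> uw; have [m] := ubnP (num v); elim: m v => // m IH v v_m /andP[uv vw].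
have vs := preorder_neq_root uv.
have [fv _ scanned] := preorder_parent vs.
apply: ancestor_trans (ancestor_parent f vs).
have [u_f|f_u|/preorder_inj<-] := ltngtP (num u) (num (f v)); last exact: ancestor_refl.
  by apply: IH; rewrite ?(leq_trans fv) // u_f (leq_trans (ltnW fv)).
by have := scanned u w; rewrite f_u uv => /(_ isT uw); rewrite ltnNge vw.
Qed.

Lemma ancestor_preorder u v : anc u v -> num u <= num v.
Proof.
have [->//|neq] := eqVneq u v.
move/(@ancestor_rel _ _ _ [rel x y | num x < num y])/(_ neq)=> /= lt.
apply/ltnW/lt => [x y z|x xs]; first exact: ltn_trans.
by have [] := preorder_parent xs.
Qed.

Lemma ancestor_interval u w x :
  anc u w -> num u <= num x <= num w -> anc u x.
Proof.
have [m] := ubnP (num w); elim: m w => // m IH w w_m uw /andP[ux].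
rewrite leq_eqVlt => /orP[/eqP/preorder_inj->//|xw].
have [ws uf] : w != s /\ anc u (f w).
  by apply: ancestor_via_parent uw _; apply: contraTneq xw => <-; rewrite -leqNgt.
have [fw ew _] := preorder_parent ws.
have [xf|fx] := leqP (num x) (num (f w)).
  by apply: (IH (f w)); rewrite ?ux // (leq_trans fw).
by apply: ancestor_trans uf _; apply: crossing_arc_ancestor ew _; rewrite fx ltnW.
Qed.

Lemma dfs_preorder_tree : preorder_tree anc num s.
Proof.
split=> [|||||u w x].
- exact: ancestor_refl.
- exact: ancestor_trans.
- move=> v.
  apply: (@ancestor_root _ _ _ [rel x y | num x < num y]) => [x y z|x xs|x] /=.
  + exact: ltn_trans.
  + by have [] := preorder_parent xs.
  + exact: ltnn.
- exact: ancestor_preorder.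
- exact: preorder_inj.
exact: ancestor_interval.
Qed.

Lemma path_ancestor u p : path e u p -> {in p, forall x, num u <= num x} ->
  anc u (last u p).
Proof.
elim/last_ind: p => [|p x IH]; first by rewrite ancestor_refl.
rewrite rcons_path last_rcons => /andP[up ex] ge.
have uc : anc u (last u p).
  by apply: IH up _ => y yp; apply: ge; rewrite mem_rcons inE yp orbT.
have [xc|cx] := leqP (num x) (num (last u p)).
  by apply: ancestor_interval uc _; rewrite ge ?mem_rcons ?mem_head.
by apply: ancestor_trans uc (crossing_arc_ancestor ex _); rewrite cx leqnn.
Qed.

End DepthFirstSearch.

Lemma path_last_sat (T : eqType) (e : rel T) (P : pred T) x p :
  path e x p -> P x ->
  exists a q, [/\ P a, path e a q, last a q = last x p,
                  {in q, forall y, ~~ P y} & {subset q <= p}].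
Proof.
elim/last_ind: p => [|p y IH]; first by exists x, [::].
rewrite rcons_path last_rcons => /andP[xp py] Px.
have [Py|nPy] := boolP (P y); first by exists y, [::].
have [a [q [Pa aq lq nPq qp]]] := IH xp Px; exists a, (rcons q y).
split; rewrite ?last_rcons ?rcons_path ?aq ?lq // => z; rewrite !mem_rcons !inE.
  by case/predU1P=> [->//|/nPq].
by case/predU1P=> [->|/qp->]; rewrite ?eqxx ?orbT.
Qed.

Lemma high_path_rcons (V : finType) (e : rel V) (num : V -> nat) u v p :
  high_path e num u v (rcons p v) ->
  {in p, forall x, (num u < num x) && (num v < num x)}.
Proof.
case=> -[_ _ /=]; rewrite mem_rcons rcons_uniq inE negb_or.
case/and3P=> /andP[_ up] vp _ high x xp; apply: high.
- by rewrite inE mem_rcons inE xp !orbT.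
- by apply: contraNneq up => <-.
- by apply: contraNneq vp => <-.
Qed.

Section Semidominators.

Variables (V : finType) (e : rel V) (s : V) (f : V -> V) (o : seq V) (sd : V -> V).
Hypothesis F_dfs : dfs_spanning_tree e s f o.
Hypothesis sdP : forall v, v != s -> is_semidominator e (preorder o) v (sd v).

Local Notation anc := (ancestor s f).
Local Notation num := (preorder o).
Local Notation low := (fun v => num (sd v)).
Local Notation minlow := (minlow anc num low).

Let treeP := dfs_preorder_tree F_dfs.

Implicit Types (a t v w x : V) (p : seq V).

Lemma semidominator_lt v : v != s -> num (sd v) < num v.
Proof.
move=> vs; have [fv ev _] := preorder_parent F_dfs vs.
apply: leq_ltn_trans (fv); apply: (sdP vs).2; exists [:: v]; split.
  split=> //=; first by rewrite ev.
  by rewrite mem_seq1 andbT (ltn_image_neq fv).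
by move=> x; rewrite !inE => /pred2P[]->; rewrite eqxx.
Qed.

Lemma semidominator_le a v p : v != s -> path e a p -> last a p = v ->
  {in p, forall x, x != v -> num v < num x} -> num (sd v) <= num a.
Proof.
move=> vs ap lp high; have [va|av] := leqP (num v) (num a).
  exact: leq_trans (ltnW (semidominator_lt vs)) va.
case/shortenP: ap lp => q aq uq qp lq; apply: (sdP vs).2; exists q; split=> //.
move=> x; rewrite inE => /predU1P[->|/qp/high vx _ /vx lt]; first by rewrite eqxx.
by rewrite (ltn_trans av).
Qed.

Lemma semidominator_le_parent v : v != s -> num (sd v) <= num (f v).
Proof.
move=> vs; have [_ ev _] := preorder_parent F_dfs vs.
apply: (@semidominator_le _ _ [:: v]) => //=; first by rewrite ev.
by move=> x; rewrite inE => ->.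
Qed.

Lemma last_arc_ancestor v w : v != s ->
  last_arc_of_high_path e num (sd v) v w -> anc (sd v) w.
Proof.
move=> vs [_ [p [high <-]]]; have [[] + _ _ _] := high.
rewrite rcons_path => /andP[sp _]; apply: (path_ancestor F_dfs sp) => x xp.
by have /andP[/ltnW] := high_path_rcons high xp.
Qed.

Lemma semidominator_ancestor v : v != s -> anc (sd v) v.
Proof.
move=> vs; have [[p [[sp lp _] high]] _] := sdP vs; rewrite -{2}lp.
apply: (path_ancestor F_dfs sp) => x xp.
have [->//|xs] := eqVneq x (sd v).
have [->|xv] := eqVneq x v; first exact/ltnW/semidominator_lt.
by have /andP[/ltnW] := high x (mem_behead (s := sd v :: p) xp) xs xv.
Qed.

Lemma last_arc_cases v w : last_arc_of_high_path e num (sd v) v w ->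
  w = sd v \/ num v < num w.
Proof.
case=> _ [p [high <-]]; case/lastP: p high => [|p x] high; [by left|right].
have /(high_path_rcons high)/andP[_] : x \in rcons p x by rewrite mem_rcons mem_head.
by rewrite last_rcons.
Qed.

(* The witness is the minimum of the path: everything after it descends from
   it, and everything before it is greater than it. *)
Lemma path_semidominator a p : path e a p -> p != [::] -> s \notin p ->
  exists2 b, b \in p & anc b (last a p) /\ num (sd b) <= num a.
Proof.
case: p => // y p' ap _ sp; set p := y :: p' in ap sp *.
case: (arg_minnP (P := mem p) num (mem_head y p')) => b bp b_min; exists b => //.
have bs : b != s by apply: contraNneq sp => <-.
case/splitPr: bp ap b_min => p1 p2; rewrite cat_path last_cat /=.
case/and3P=> ap1 eb bp2 b_min; split.
  apply: (path_ancestor F_dfs bp2) => x xp2.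
  by apply: b_min; rewrite mem_cat inE xp2 !orbT.
apply: (@semidominator_le _ _ (rcons p1 b)); rewrite ?rcons_path ?ap1 ?last_rcons //.
move=> x; rewrite mem_rcons inE => /predU1P[->|xp1 xb]; first by rewrite eqxx.
by rewrite (neq_num_lt treeP) 1?eq_sym // b_min // mem_cat xp1.
Qed.

Lemma semidominator_le_arc v w x : v != s -> e w v -> anc x w -> num v < num x ->
  num (sd v) <= num (sd x).
Proof.
move=> vs ewv /connectP[r xr lr] vx; have xs := preorder_neq_root F_dfs vx.
have [[q [[sq lq uq] high]] _] := sdP xs.
apply: (@semidominator_le _ _ (q ++ rcons r v)) => //.
- rewrite cat_path sq lq rcons_path -lr ewv andbT.
  apply: sub_path xr => y z /andP[zs /eqP->].
  by have [] := preorder_parent F_dfs zs.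
- by rewrite last_cat last_rcons.
move=> y; rewrite mem_cat mem_rcons inE orbCA => /predU1P[->|yqr _].
  by rewrite eqxx.
apply: leq_trans vx _; case/orP: yqr => [yq|yr].
  have [->//|yx] := eqVneq y x.
  have y_sd : y != sd x by apply: contraTneq uq => <-; rewrite /= yq.
  by have /andP[_ /ltnW] := high y (mem_behead (s := sd x :: q) yq) y_sd yx.
by apply/(anc_num treeP)/(path_connect xr); rewrite inE yr orbT.
Qed.

(* The Lengauer-Tarjan recurrence for semidominators, at an arc that attains
   its minimum. *)
Lemma minlow_last_arc v w : v != s ->
  last_arc_of_high_path e num (sd v) v w -> num v < num w ->
  minlow w (num v) = num (sd v).
Proof.
move=> vs [ewv [p [high lp]]] vw; have [[sp _ _] _] := high.
apply/eqP; rewrite eqn_leq; apply/andP; split; last first.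
  apply: leq_minlow => [|x xw]; first exact/ltnW/semidominator_lt.
  exact: semidominator_le_arc vs ewv xw.
have gt x : x \in p -> num v < num x by case/(high_path_rcons high)/andP.
move: sp; rewrite rcons_path lp => /andP[sp _].
have [||x xp [xw sx]] := path_semidominator sp.
- by apply: contraTneq vw => p0; rewrite -lp p0 -leqNgt ltnW ?semidominator_lt.
- by apply/negP=> /gt/(preorder_neq_root F_dfs)/eqP.
by apply: leq_trans sx; apply: minlow_le_low; [rewrite -lp | apply: gt].
Qed.

Lemma dominates_of_minlow t v : anc t v -> minlow v (num t) = num t ->
  dominates e s t v.
Proof.
move=> tv m_t p [sp lp _]; apply/negPn/negP; rewrite inE negb_or => /andP[ts tp].
have s_lt : num s < num t.
  by rewrite (neq_num_lt treeP) 1?eq_sym // (preorder_root F_dfs).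
have [a [q [a_lt aq lq q_ge qp]]] :=
  path_last_sat (P := fun x => num x < num t) sp s_lt.
have gt x : x \in q -> num t < num x.
  move=> xq; apply: (neq_num_lt treeP); last by rewrite leqNgt; apply: q_ge.
  by apply: contraNneq tp => ->; apply: qp.
have [||c cq [cv sc]] := path_semidominator aq.
- apply: contraTneq a_lt => q0; move: lq; rewrite q0 lp /= => ->.
  by rewrite -leqNgt (anc_num treeP).
- by apply/negP=> /gt/(preorder_neq_root F_dfs)/eqP.
have : minlow v (num t) <= num (sd c).
  by apply: minlow_le_low; [rewrite -lp -lq | apply: gt].
by rewrite m_t leqNgt (leq_ltn_trans sc a_lt).
Qed.

Lemma on_tree_pathP v x : v != s ->
  on_tree_path s f (sd v) v x <-> anc x v /\ num (sd v) < num x.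
Proof.
move=> vs; split=> [[c [/andP[cs /eqP sc] cx xv]]|[xv lt]].
  split=> //; rewrite sc; have [fc _ _] := preorder_parent F_dfs cs.
  exact: leq_trans fc (ancestor_preorder F_dfs cx).
have sx := anc_linear treeP (semidominator_ancestor vs) xv (ltnW lt).
have [|c sc cx] := ancestor_via_child sx; last by exists c.
exact: ltn_image_neq lt.
Qed.

End Semidominators.

Section ColoredTrees.

Variables (V : finType) (e : rel V) (s : V) (f : V -> V) (o : seq V) (sd rd g : V -> V).
Hypothesis F_dfs : dfs_spanning_tree e s f o.
Hypothesis sdP : forall v, v != s -> is_semidominator e (preorder o) v (sd v).
Hypothesis rdP :
  forall v, v != s -> is_relative_dominator s f (preorder o) sd v (rd v).
Hypothesis gP :
  forall v, v != s -> last_arc_of_high_path e (preorder o) (sd v) v (g v).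

Local Notation anc := (ancestor s f).
Local Notation num := (preorder o).
Local Notation low := (fun v => num (sd v)).
Local Notation minlow := (minlow anc num low).
Local Notation height := (height anc num low).
Local Notation precedes := (precedes anc num low s).

Let treeP := dfs_preorder_tree F_dfs.

Implicit Types (k : bool) (t v : V).

Lemma minlow_parent v : v != s -> minlow v (num (f v)) = num (sd v).
Proof.
move=> vs; have [fv _ _] := preorder_parent F_dfs vs.
apply/eqP; rewrite eqn_leq minlow_le_low ?(anc_refl treeP) //=.
apply: leq_minlow => [|u uv]; first exact: semidominator_le_parent F_dfs sdP _ vs.
have [->//|neq] := eqVneq u v; have [_ uf] := ancestor_via_parent uv neq.
by rewrite ltnNge (anc_num treeP uf).
Qed.

Lemma relative_dominator_on_path v : v != s -> anc (rd v) v /\ num (sd v) < num (rd v).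
Proof. by move=> vs; have [/(on_tree_pathP F_dfs sdP _ vs)] := rdP vs. Qed.

Lemma minlow_semidominator v : v != s -> minlow v (num (sd v)) = num (sd (rd v)).
Proof.
move=> vs; have [qv lt] := relative_dominator_on_path vs.
have [_ q_min] := rdP vs.
have q_le u : anc u v -> num (sd v) < num u -> num (sd (rd v)) <= num (sd u).
  move=> uv lu; have /q_min := (on_tree_pathP F_dfs sdP u vs).2 (conj uv lu).
  by case/orP=> [/ltnW//|/andP[/eqP<-]].
apply/eqP; rewrite eqn_leq minlow_le_low //= leq_minlow //.
by apply: q_le; [apply: anc_refl treeP _ | apply: semidominator_lt F_dfs sdP _ vs].
Qed.

Definition descent_parity v := odd (height v (num (sd v))).

Lemma descent_parity_rd v : v != s ->
  descent_parity v = (sd v != sd (rd v)) && ~~ descent_parity (rd v).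
Proof.
move=> vs; have [qv lt] := relative_dominator_on_path vs.
have m_v := minlow_semidominator vs; rewrite /descent_parity.
have [E|neq] := eqVneq (sd v) (sd (rd v)).
  by rewrite /height descent_fix ?odd_double // m_v E.
have q_lt : minlow v (num (sd v)) < num (sd v).
  by rewrite m_v (neq_num_lt treeP) 1?eq_sym // -m_v minlow_le.
rewrite /height (descent_step q_lt) m_v -/(height v _) (height_anc treeP qv) //.
by rewrite -m_v; apply/minlow_mono/ltnW.
Qed.

Definition colored_parent k v := if descent_parity v == k then g v else f v.

Lemma colored_parent_arc k v : v != s -> e (colored_parent k v) v.
Proof.
move=> vs; rewrite /colored_parent; case: ifP => _; first by have [] := gP vs.
by have [] := preorder_parent F_dfs vs.
Qed.

Lemma precedes_parent k v : v != s -> descent_parity v != k -> precedes k (f v) v.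
Proof.
move=> vs odd_v; have [fv _ _] := preorder_parent F_dfs vs.
rewrite (precedes_anc _ treeP) ?ancestor_parent ?(ltn_image_neq fv) // minlow_parent //.
case: eqVneq => //= sf.
have lt : minlow v (num (f v)) < num (f v).
  by rewrite minlow_parent // ltn_neqAle sf (semidominator_le_parent F_dfs sdP).
rewrite /height (descent_step lt) minlow_parent //= -/(height v _) -/(descent_parity v).
by move: odd_v; case: descent_parity; case: k.
Qed.

Lemma precedes_last_arc k v : v != s -> descent_parity v = k -> precedes k (g v) v.
Proof.
move=> vs odd_v; have sv := semidominator_lt F_dfs sdP vs.
have sd_anc := semidominator_ancestor F_dfs sdP vs.
have [->|vg] := last_arc_cases (gP vs).
  by rewrite (precedes_anc _ treeP) ?(ltn_image_neq sv) // -odd_v eqxx orbT.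
have [_ _ nca_max] := ncaP treeP (g v) v.
apply: precedes_cross (odd_v) => //; last exact: minlow_last_arc (gP vs) vg.
by apply/(anc_num treeP)/nca_max => //; apply: last_arc_ancestor (gP vs).
Qed.

Lemma precedes_colored_parent k v : v != s -> precedes k (colored_parent k v) v.
Proof.
move=> vs; rewrite /colored_parent; case: eqVneq => odd_v.
  exact: precedes_last_arc.
exact: precedes_parent.
Qed.

Section ColoredTree.

Variables (k : bool) (h : V -> V).
Hypothesis hE : forall v, v != s -> h v = colored_parent k v.

Lemma precedes_tree_parent v : v != s -> precedes k (h v) v.
Proof. by move=> vs; rewrite hE // precedes_colored_parent. Qed.

Lemma colored_ancestor_precedes t v : ancestor s h t v -> t != v -> precedes k t v.
Proof. by move/(ancestor_rel (precedes_trans treeP (k := k)) precedes_tree_parent). Qed.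

Lemma colored_spanning_tree : spanning_tree e s (parent_graph s h).
Proof.
apply: parent_graph_spanning_tree => v.
  by move/[dup]/hE->; apply: colored_parent_arc.
apply: (ancestor_root (precedes_trans treeP (k := k)) precedes_tree_parent).
exact: precedes_irr.
Qed.

End ColoredTree.

Lemma colored_trees_independent b r :
  (forall v, v != s -> b v = colored_parent false v) ->
  (forall v, v != s -> r v = colored_parent true v) ->
  independent e s (parent_graph s b) (parent_graph s r).
Proof.
move=> bE rE v p q vp vq x /(mem_path_ancestor vp) bx /(mem_path_ancestor vq) rx.
have [->|xv] := eqVneq x v; first by move=> l [_ <- _]; apply: mem_last.
have [x_anc m_x] := precedes_both treeP
  (colored_ancestor_precedes bE bx xv) (colored_ancestor_precedes rE rx xv).
exact: dominates_of_minlow F_dfs sdP _ _ x_anc m_x.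
Qed.

Lemma last_arc_neq_parent v : v != s -> sd v != f v -> g v != f v.
Proof.
move=> vs; apply: contra_neq => gf; have [<-//|] := last_arc_cases (gP vs).
by have [fv _ _] := preorder_parent F_dfs vs; rewrite gf ltnNge ltnW.
Qed.

Definition takes_last_arc (b : V -> V) v :=
  (sd v == sd (rd v)) || (b (rd v) == f (rd v)).

Lemma br_stepE br v : br_step f sd rd g br v =
  (update br.1 v (if takes_last_arc br.1 v then g v else f v),
   update br.2 v (if takes_last_arc br.1 v then f v else g v)).
Proof. by case: br => b r; rewrite /br_step /takes_last_arc; case: ifP. Qed.

Lemma foldl_br_step_notin l br v (br' := foldl (br_step f sd rd g) br l) :
  v \notin l -> br'.1 v = br.1 v /\ br'.2 v = br.2 v.
Proof.
rewrite {}/br'; elim: l br => //= x l IH br; rewrite inE negb_or => /andP[vx vl].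
have [-> ->] := IH (br_step f sd rd g br x) vl.
by rewrite br_stepE /update /= (negPf vx).
Qed.

Lemma relative_dominator_lt v : v != s -> sd v != sd (rd v) -> num (rd v) < num v.
Proof.
move=> vs neq; have [qv _] := relative_dominator_on_path vs.
by rewrite (neq_num_lt treeP) ?(anc_num treeP) //; apply: contra_neq neq => ->.
Qed.

Lemma br_trees_rec v (br := br_trees s o f sd rd g) : v != s ->
  br.1 v = (if takes_last_arc br.1 v then g v else f v) /\
  br.2 v = (if takes_last_arc br.1 v then f v else g v).
Proof.
rewrite {}/br /br_trees => vs; have [l oE] := dfs_head F_dfs.1.
have := dfs_uniq F_dfs.1; rewrite {1}oE /= => /andP[sl ul].
have -> : [seq x <- o | x != s] = l.
  by rewrite oE /= eqxx; apply/all_filterP/allP => x xl /=; apply: contraNneq sl => <-.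
have vl : v \in l by have := F_dfs.2 v; rewrite oE inE (negPf vs).
case/splitPr: vl oE ul sl => l1 l2 oE ul _.
move: ul; rewrite cat_uniq => /and3P[_ /hasPn l1_disj /andP[vl2 _]].
rewrite foldl_cat; set br := foldl _ _ l1; set fin := foldl _ _ (v :: l2).
have takesE : takes_last_arc fin.1 v = takes_last_arc br.1 v.
  rewrite /takes_last_arc; case: eqVneq => //= neq; congr (_ == _).
  have [_ lt] := relative_dominator_on_path vs.
  have := relative_dominator_lt vs neq.
  have vl1 : v \notin s :: l1 by rewrite inE (negPf vs); apply/l1_disj/mem_head.
  rewrite /preorder ltnS oE -cat_cons index_lt_split // inE.
  rewrite (negPf (preorder_neq_root F_dfs lt)) => ql1.
  have ql2 : rd v \notin v :: l2 by apply: contraL ql1; apply: l1_disj.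
  by rewrite (foldl_br_step_notin br ql2).1.
have [b_kept r_kept] := foldl_br_step_notin (br_step f sd rd g br v) vl2.
by rewrite takesE /fin /= b_kept r_kept br_stepE /update /= eqxx.
Qed.

Lemma br_treesE v : v != s ->
  (br_trees s o f sd rd g).1 v = colored_parent false v /\
  (br_trees s o f sd rd g).2 v = colored_parent true v.
Proof.
have [m] := ubnP (num v); elim: m v => // m IH v v_m vs.
have [-> ->] := br_trees_rec vs; set b := (br_trees s o f sd rd g).1 in IH *.
suff -> : takes_last_arc b v = ~~ descent_parity v.
  by rewrite /colored_parent; case: descent_parity.
rewrite descent_parity_rd // negb_and !negbK /takes_last_arc; case: eqVneq => //= neq.
have [qv lt] := relative_dominator_on_path vs.
have qs := preorder_neq_root F_dfs lt.
have [-> _] := IH _ (leq_trans (relative_dominator_lt vs neq) v_m) qs.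
rewrite /colored_parent.
case: descent_parity; rewrite /= ?eqxx //; apply/negbTE/last_arc_neq_parent => //.
have sd_q : num (sd (rd v)) < num (sd v).
  by rewrite (neq_num_lt treeP) 1?eq_sym // -minlow_semidominator // minlow_le.
have sd_anc := anc_linear treeP (semidominator_ancestor F_dfs sdP vs) qv (ltnW lt).
have [|_ /(anc_num treeP) sd_f] := ancestor_via_parent sd_anc.
  exact: ltn_image_neq lt.
exact: ltn_image_neq (leq_trans sd_q sd_f).
Qed.

End ColoredTrees.

Theorem theorem38 (V : finType) (e : rel V) (s : V)
    (f : V -> V) (o : seq V) (sd rd g : V -> V)
    (G_flow : flow_graph e s)
    (F_dfs : dfs_spanning_tree e s f o)
    (sdP : forall v : V, v != s -> is_semidominator e (preorder o) v (sd v))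
    (rdP : forall v : V, v != s -> is_relative_dominator s f (preorder o) sd v (rd v))
    (gP : forall v : V, v != s ->
       last_arc_of_high_path e (preorder o) (sd v) v (g v)) :
  let: (b, r) := br_trees s o f sd rd g in
  let B := parent_graph s b in
  let R := parent_graph s r in
  [/\ spanning_tree e s B, spanning_tree e s R & independent e s B R].
Proof.
have := br_treesE F_dfs sdP rdP gP; case: (br_trees _ _ _ _ _ _) => b r /= brE.
have bE v vs := (brE v vs).1; have rE v vs := (brE v vs).2.
split.
- exact: (colored_spanning_tree F_dfs sdP gP bE).
- exact: (colored_spanning_tree F_dfs sdP gP rE).
exact: (colored_trees_independent F_dfs sdP gP bE rE).
Qed.
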